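(* Let $G$ be a finite connected graph. Then $\chi_{DP}^\ast(G) \leq 2$ if and only if $G$ contains no odd cycles and at most one even cycle. Furthermore, if $G$ contains no odd cycles and exactly one even cycle, then $\chi_{DP}^\ast(G) = 2$, while $\theta_{DP}(G,k)^{-1} > 2$ for every positive integer $k$ (i.e., the infimum defining $\chi_{DP}^\ast(G)$ is not attained).
   Context: All graphs are finite, without loops or multiple edges. A cover of a graph $G$ is a pair $(L,H)$ where $H$ is a graph and $L\colon V(G)\to 2^{V(H)}$ satisfies: the sets $L(u)$, $u\in V(G)$, partition $V(H)$; each $H[L(u)]$ is complete; if there is an edge of $H$ between $L(u)$ and $L(v)$ with $u\neq v$ then $uv\in E(G)$; and for each $uv\in E(G)$ the edges of $H$ between $L(u)$ and $L(v)$ form a (not necessarily perfect, possibly empty) matching. The cover is $k$-fold if $|L(u)|=k$ for all $u$. Edges of $H$ joining different sets $L(u)\ne L(v)$ are cross-edges; $S\subseteq V(H)$ is quasi-independent if it spans no cross-edges. For $\eta\in[0,1]$, an $(\eta,(L,H))$-coloring of $G$ is a quasi-independent $S\subseteq V(H)$ with $|S\cap L(u)|\geq \eta|L(u)|$ for all $u\in V(G)$. For $k\in\mathbb{N}^+$, $\theta_{DP}(G,k)$ is the maximum $\eta\in[0,1]$ such that $G$ admits an $(\eta,\mathcal{H})$-coloring for every $k$-fold cover $\mathcal{H}$ of $G$, and the fractional DP-chromatic number is $\chi_{DP}^\ast(G)=\inf\{\theta_{DP}(G,k)^{-1}: k\in\mathbb{N}^+\}$. *)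

(* Defs.v *)
From HB Require Import structures.
From mathcomp Require Import all_boot all_order all_algebra.
From mathcomp Require Import boolp classical_sets reals constructive_ereal ereal.

Set Implicit Arguments.
Unset Strict Implicit.
Unset Printing Implicit Defensive.

Import Order.TTheory GRing.Theory Num.Theory.

Record sgraph := SGraph {
  vertex :> finType;
  edge : rel vertex;
  edge_sym : symmetric edge;
  edge_irr : irreflexive edge }.

Arguments edge {s} _ _.

Definition connected_graph (G : sgraph) : Prop :=
  0 < #|G| /\ forall x y : G, connect edge x y.

(* The edges of H with one end in A and the other in B, oriented from A to B. *)
Definition edges_between (H : sgraph) (A B : {set H}) : {set H * H} :=
  [set p | [&& p.1 \in A, p.2 \in B & edge p.1 p.2]].

(* For oriented edges between two disjoint sets, sharing an end means agreeing
   on the first or on the second component. *)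
Definition is_matching (H : sgraph) (M : {set H * H}) : Prop :=
  forall p q, p \in M -> q \in M -> p.1 = q.1 \/ p.2 = q.2 -> p = q.

Definition is_clique (H : sgraph) (A : {set H}) : Prop :=
  {in A &, forall x y, x != y -> edge x y}.

Definition is_cover (G H : sgraph) (L : G -> {set H}) : Prop :=
  [/\ (forall u v, u != v -> [disjoint L u & L v])
        /\ \bigcup_u L u = [set: H],
      forall u, is_clique (L u),
      forall u v, u != v -> edges_between (L u) (L v) != finset.set0 -> edge u v
    & forall u v, edge u v -> is_matching (edges_between (L u) (L v))].

Definition is_fold_cover (k : nat) (G H : sgraph) (L : G -> {set H}) : Prop :=
  is_cover L /\ forall u, #|L u| = k.

Definition quasi_independent (G H : sgraph) (L : G -> {set H})
    (S : {set H}) : Prop :=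
  forall u v, u != v -> edges_between (S :&: L u) (S :&: L v) = finset.set0.

Definition is_coloring (R : realType) (G H : sgraph) (L : G -> {set H})
    (eta : R) (S : {set H}) : Prop :=
  quasi_independent L S /\
  forall u, (eta * #|L u|%:R <= #|S :&: L u|%:R)%R.

Definition DP_feasible (R : realType) (G : sgraph) (k : nat) : set R :=
  [set eta : R | (0 <= eta <= 1)%R /\
    forall (H : sgraph) (L : G -> {set H}), is_fold_cover k L ->
      exists S, is_coloring L eta S]%classic.

Arguments DP_feasible : clear implicits.

(* The supremum is a maximum, see [theta_DP_max]. *)
Definition theta_DP (R : realType) (G : sgraph) (k : nat) : R :=
  sup (DP_feasible R G k).

(* The inverse is taken in the extended reals, where 0^-1 = +oo; this matters,
   since theta_DP can vanish. *)
Definition inv_theta_DP (R : realType) (G : sgraph) (k : nat) : \bar R :=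
  ((theta_DP R G k)%:E^-1)%E.

Definition chi_DP_frac (R : realType) (G : sgraph) : \bar R :=
  ereal_inf [set inv_theta_DP R G k | k in [set k | 0 < k]]%classic.

Definition cycle_edges (G : sgraph) (c : seq G) : {set {set G}} :=
  [set [set x; next c x] | x in c].

(* A cycle of G is a subgraph, identified with its set of edges: the closed
   walks obtained from one another by rotation or reversal yield one cycle. *)
Definition is_cycle (G : sgraph) (n : nat) (C : {set {set G}}) : Prop :=
  exists c : seq G, [/\ size c = n, 2 < n, ucycle edge c & C = cycle_edges c].

Definition odd_cycle (G : sgraph) (C : {set {set G}}) : Prop :=
  exists2 n, odd n & is_cycle n C.

Definition even_cycle (G : sgraph) (C : {set {set G}}) : Prop :=
  exists2 n, ~~ odd n & is_cycle n C.

Definition no_odd_cycle (G : sgraph) : Prop :=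
  forall C : {set {set G}}, ~ odd_cycle C.

Definition at_most_one_even_cycle (G : sgraph) : Prop :=
  forall C D : {set {set G}}, even_cycle C -> even_cycle D -> C = D.

Definition exactly_one_even_cycle (G : sgraph) : Prop :=
  exists! C : {set {set G}}, even_cycle C.

Section ThetaMax.
Local Open Scope classical_set_scope.
Local Open Scope ring_scope.
Variables (R : realType) (G : sgraph) (k : nat).

Lemma DP_feasible0 : DP_feasible R G k 0.
Proof.
split=> [|H L _]; first by rewrite lexx ler01.
exists finset.set0; split=> u; last by rewrite mul0r.
by move=> v _; apply/setP=> p; rewrite !inE.
Qed.

Lemma theta_DP_max :
  DP_feasible R G k (theta_DP R G k) /\
  forall eta, DP_feasible R G k eta -> eta <= theta_DP R G k.
Proof.
have ubE : has_ubound (DP_feasible R G k) by exists 1 => x [/andP[]].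
have neE : DP_feasible R G k !=set0 by exists 0; exact: DP_feasible0.
have le_theta eta : DP_feasible R G k eta -> eta <= theta_DP R G k.
  exact: ub_le_sup.
split=> //; split.
  apply/andP; split; first exact: le_theta DP_feasible0.
  by apply: ge_sup => // x [/andP[]].
move=> H L HL; apply: contrapT => noS.
set t := theta_DP R G k in noS.
have [f f_gt0 fP] : exists2 f : {set H} -> R, (forall S, 0 < f S) &
    forall S, ~ is_coloring L (t - f S) S.
  suff /choice[f fP] : forall S : {set H}, exists e : R,
      0 < e /\ ~ is_coloring L (t - e) S.
    by exists f => S; case: (fP S).
  move=> S; have [qS|nqS] := pselect (quasi_independent L S); last first.
    by exists 1; split=> // -[].
  have [u] : exists u, ~ (t * #|L u|%:R <= #|S :&: L u|%:R).
    by apply/existsNP => tS; apply: noS; exists S.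
  move/negP; rewrite -ltNge => ltS.
  pose d := t * #|L u|%:R - #|S :&: L u|%:R.
  have d_gt0 : 0 < d by rewrite subr_gt0.
  have n_gt0 : 0 < #|L u|.+1%:R :> R by rewrite ltr0n.
  exists (d / #|L u|.+1%:R); split; first by rewrite divr_gt0.
  case=> _ /(_ u); rewrite leNgt => /negP; apply.
  rewrite mulrBl ltrBrDr -ltrBrDl -/d.
  by rewrite mulrAC ltr_pdivrMr// ltr_pM2l// ltr_nat.
pose e := \big[Order.min/1]_(S : {set H}) f S.
have e_gt0 : 0 < e by apply: (big_ind (fun x => 0 < x)) => // x y x0 y0; rewrite lt_min x0.
have e_le S : e <= f S by rewrite /e (bigD1 S)//= ge_min lexx.
have [x [_ /(_ H L HL)[S [qS xS]]] tx] :=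
  sup_adherent e_gt0 (conj neE ubE).
apply: (fP S); split=> // u; apply: le_trans (xS u).
rewrite ler_wpM2r// (le_trans _ (ltW tx))// lerB//.
Qed.

End ThetaMax.

(* Main.v *)
Require Import Defs.
From mathcomp Require Import all_boot all_order all_algebra.
From mathcomp Require Import boolp classical_sets reals constructive_ereal ereal.
From mathcomp Require Import all_fingroup primitive_action alt finset zify ring.

(* Lower bounds come from the covers of G with vertex set V(G) x [k] given by a
   permutation of [k] on every edge.
   - Odd cycle of length n: for identity permutations each label is used on an
     independent set of the cycle, so theta <= (n - 1) / 2n for every k.
   - Even cycle: put a cyclic shift on one edge of the cycle and identities
     elsewhere. A 1/2-coloring has to alternate between a set and its complement
     along the cycle, so this set of size k/2 is shift-invariant, which is absurd.
   - Two even cycles: a connected G then has at least n + 1 edges on n vertices.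
     For fixed a-subsets A and B of [k], a random permutation maps A off B with
     probability C(k - a, a) / C(k, a), so by the union bound some choice of
     permutations admits no coloring by a-sets as soon as
     C(k - a, a)^m < C(k, a), m being the number of edges. This holds when
     k - 2a is small compared with a, which keeps theta below 1/2 uniformly in k.
   Upper bound: remove one edge of the even cycle. Along the remaining spanning
   tree the cover can be trivialised, and the removed edge becomes a permutation
   sigma. Some a-set A of labels, k = 2a, loses at most one element under sigma;
   alternating A and its complement by the parity of the level yields
   theta >= (a - 1) / 2a. *)

Set Implicit Arguments.
Unset Strict Implicit.
Unset Printing Implicit Defensive.

Import Order.TTheory GRing.Theory Num.Theory.

(** * Cycles and spanning trees *)

Lemma set2_eq (T : finType) (a b u v : T) :
  [set a; b] = [set u; v] -> a = u /\ b = v \/ a = v /\ b = u.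
Proof.
move=> E; have /set2P ha : a \in [set u; v] by rewrite -E set21.
have /set2P hb : b \in [set u; v] by rewrite -E set22.
have /set2P hu : u \in [set a; b] by rewrite E set21.
have /set2P hv : v \in [set a; b] by rewrite E set22.
by case: ha => ha; case: hb => hb; case: hu => hu; case: hv => hv; subst; auto.
Qed.

Section Deletion.
Variable G : sgraph.
Implicit Types (r : rel G) (s : {set G}).

Definition del_edge r s : rel G := fun u v => r u v && ([set u; v] != s).

Lemma del_edge_sym r s : symmetric r -> symmetric (del_edge r s).
Proof. by move=> rC u v; rewrite /del_edge rC finset.setUC. Qed.

(** As [t] is nonempty, the way back from [y] to [x] never uses the edge [xy]: [x] occurs only at
    its end, and the step into [x] does not start at [y]. *)
Lemma ucycle_del r x y t : t != [::] -> ucycle r [:: x, y & t] ->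
  path (del_edge r [set x; y]) y (rcons t x).
Proof.
move=> tn /andP[] /= /andP[_].
rewrite inE negb_or -!andbA => rt /and4P[nxy xt yt ut].
have: all (predC1 x) (y :: t).
  apply/allP => z; rewrite inE => /predU1P[->|zt] /=; first by rewrite eq_sym.
  by apply: contraNneq xt => <-.
have ly : last y t != y.
  by case: t tn yt {xt ut rt} => //= z t _; apply: contraNneq => <-; exact: mem_last.
suff gen w : path r w (rcons t x) -> last w t != y -> all (predC1 x) (w :: t) ->
    path (del_edge r [set x; y]) w (rcons t x) by exact: gen.
elim: t w {tn xt ut yt rt ly} => [|z t IH] w /=.
  rewrite !andbT /del_edge => -> wy wx /=.
  by apply/eqP => /set2_eq[[E _]|[E _]]; rewrite E eqxx in wx wy.
move=> /andP[rwz rt] ly /and3P[wx zx tx]; rewrite {1}/del_edge rwz /=.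
apply/andP; split; last by apply: IH; rewrite //= zx.
by apply/eqP => /set2_eq[[E _]|[_ E]]; [move: wx|move: zx]; rewrite /= E eqxx.
Qed.

Lemma cycle_edgesP r c s : ucycle r c -> 2 < size c -> s \in cycle_edges c ->
  exists x y t, [/\ s = [set x; y], t != [::], ucycle r [:: x, y & t],
    size c = (size t).+2 & cycle_edges [:: x, y & t] = cycle_edges c].
Proof.
move=> /andP[cc uc] sc /imsetP[x xc ->].
have [i c' rc] := rot_to xc.
have s' : size (x :: c') = size c by rewrite -rc size_rot.
case: c' rc s' => [|y [|z t]] rc s'; try by rewrite -s' in sc.
have ur : uniq (x :: y :: z :: t) by rewrite -rc rot_uniq.
exists x, y, (z :: t); split => //.
- by rewrite -(next_rot i uc) rc /= eqxx.
- by rewrite /ucycle ur -rc rot_cycle cc.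
- apply/setP=> u; apply/imsetP/imsetP => -[v vc ->]; exists v => //.
  + by rewrite -(mem_rot i) rc.
  + by rewrite -rc next_rot.
  + by rewrite -rc mem_rot.
  + by rewrite -rc next_rot.
Qed.

(** An edge of a cycle is not a bridge: the rest of the cycle is a detour. *)
Lemma del_edge_connect r c s : symmetric r -> ucycle r c -> 2 < size c ->
  s \in cycle_edges c -> forall u v, connect r u v -> connect (del_edge r s) u v.
Proof.
move=> rC cc sc sE; have [x [y [t [-> tn ct _ _]]]] := cycle_edgesP cc sc sE.
have dC := del_edge_sym [set x; y] rC.
have yx : connect (del_edge r [set x; y]) y x.
  by apply/connectP; exists (rcons t x); rewrite ?last_rcons ?ucycle_del.
apply: connect_sub => u v ruv; case: (eqVneq [set u; v] [set x; y]) => [|n].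
  by case/set2_eq => -[-> ->] //; rewrite (sym_connect_sym dC).
by apply: connect1; rewrite /del_edge ruv.
Qed.

Lemma ucycle_of_nonbridge r u v : symmetric r -> irreflexive r -> r u v ->
  connect (del_edge r [set u; v]) u v ->
  exists2 c, 2 < size c & ucycle r c.
Proof.
move=> rC rI ruv /connectP[p pp]; case/shortenP: pp => q pq uq _ vE.
have sub : subrel (del_edge r [set u; v]) r by move=> a b /andP[].
exists (u :: q).
  case: q pq {uq} vE => [|a [|b q]] //=.
    by move=> _ vu; rewrite vu rI in ruv.
  by move=> /[swap] <-; rewrite /del_edge eqxx andbF.
by rewrite /ucycle uq andbT /= rcons_path (sub_path sub pq) /= -vE rC.
Qed.

(** A spanning tree rooted at [x], encoded by depths [d] and parents [p]; the value of [p] at the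
    root is arbitrary. *)
Definition spans_tree r (x : G) (d : G -> nat) (p : G -> G) :=
  d x = 0 /\ forall v, v != x -> r (p v) v /\ d v = (d (p v)).+1.

Lemma bfs_tree r x : (forall v, connect r x v) ->
  exists d p, spans_tree r x d p.
Proof.
move=> cr.
pose P v n := [exists t : n.-tuple G, path r x t && (last x t == v)].
have exP v : exists n, P v n.
  have /connectP[p pp ->] := cr v.
  by exists (size p); apply/existsP; exists (in_tuple p); rewrite pp eqxx.
have intro q : path r x q -> P (last x q) (size q).
  by move=> pq; apply/existsP; exists (in_tuple q); rewrite pq eqxx.
pose d v := ex_minn (exP v).
have dle q : path r x q -> d (last x q) <= size q.
  by move=> pq; rewrite /d; case: ex_minnP => n _; apply; exact: intro.
have dx : d x = 0 by apply/eqP; rewrite -leqn0 (dle [::]).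
have /choice[p pP] v : exists w, v != x -> r w v /\ d v = (d w).+1.
  case: (eqVneq v x) => [->|vx]; first by exists x.
  have [q [pq lq sq]] : exists q, [/\ path r x q, last x q = v & size q = d v].
    rewrite /d; case: ex_minnP => n /existsP[t /andP[pt /eqP lt]] _.
    by exists t; rewrite size_tuple.
  case/lastP: q pq lq sq => [_ xv _|q w]; first by rewrite -xv eqxx in vx.
  rewrite rcons_path last_rcons size_rcons => /andP[pq rw] <- sq.
  (* The prefix [q] bounds the depth of the parent; conversely a shortest path to the parent extends
     by one edge to [w]. *)
  exists (last x q) => _; split=> //; apply/eqP; rewrite eqn_leq -{2}sq ltnS dle //.
  rewrite andbT {1}/d; case: ex_minnP => n _; apply.
  have [q' [pq' lq' <-]] : exists q', [/\ path r x q', last x q' = last x q & size q' = d (last x q)].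
    rewrite /d; case: ex_minnP => m /existsP[t /andP[pt /eqP lt]] _.
    by exists t; rewrite size_tuple.
  have := @intro (rcons q' w); rewrite last_rcons size_rcons; apply.
  by rewrite rcons_path pq' lq'.
by exists d, p.
Qed.

(** The tree avoids a non-tree edge, so deleting that edge keeps its ends connected, and it would
    close a cycle. *)
Lemma spans_tree_edges r x d p : symmetric r -> irreflexive r ->
  spans_tree r x d p -> (forall c, 2 < size c -> ~ ucycle r c) ->
  forall u v, r u v -> (v != x /\ u = p v) \/ (u != x /\ v = p u).
Proof.
move=> rC rI [dx pP] acyc u v ruv; apply: contrapT => nuv.
have dC := del_edge_sym [set u; v] rC.
have cx w : connect (del_edge r [set u; v]) x w.
  have [n] := ubnP (d w); elim: n w => // n IH w; rewrite ltnS => dw.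
  case: (eqVneq w x) => [->|wx]; first exact: connect0.
  have [rw dE] := pP w wx.
  apply: connect_trans (IH (p w) _) _; first by rewrite -dE.
  apply: connect1; rewrite /del_edge rw /=; apply/eqP => /set2_eq E; apply: nuv.
  by case: E => -[Ew Ev]; [left|right]; rewrite -Ev.
have [] := @ucycle_of_nonbridge r u v rC rI ruv; last by move=> c /acyc.
by apply: connect_trans (cx v); rewrite (sym_connect_sym dC).
Qed.

Definition edge_set r : {set {set G}} :=
  [set [set e.1; e.2] | e in [pred e : G * G | r e.1 e.2]].

(** Each non-root vertex is sent to the edge to its parent; this is injective, as the child is the
    deeper end. *)
Lemma connected_edge_set r (x : G) : (forall v, connect r x v) ->
  #|G| <= #|edge_set r|.+1.
Proof.
move=> cr; have [d [p [dx pP]]] := bfs_tree cr.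
rewrite -cardsT (cardsD1 x) inE add1n ltnS.
rewrite -(card_in_imset (f := fun v => [set p v; v])).
  apply/subset_leq_card/fintype.subsetP => _ /imsetP[v vx ->].
  move: vx; rewrite !inE andbT => vx; have [rv _] := pP v vx.
  by apply/imsetP; exists (p v, v).
move=> u v; rewrite !inE !andbT => ux vx /set2_eq[[_ //]|[Eu Ev]].
have [_ du] := pP u ux; have [_ dv] := pP v vx.
by move: du dv; rewrite Eu -Ev => ->; lia.
Qed.

Lemma edge_set_del r s : s \in edge_set r ->
  #|edge_set (del_edge r s)| < #|edge_set r|.
Proof.
move=> sr; apply/proper_card/properP; split; last first.
  exists s => //; apply/imsetP => -[[u v]]; rewrite inE /= => /andP[_].
  by move=> /eqP + sE; apply; rewrite sE.
apply/fintype.subsetP => _ /imsetP[[u v] + ->] /=; rewrite inE => /andP[ruv _].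
by apply/imsetP; exists (u, v).
Qed.

Lemma cycle_edges_sub r c : ucycle r c -> cycle_edges c \subset edge_set r.
Proof.
move=> /andP[cc _]; apply/fintype.subsetP => _ /imsetP[x xc ->].
by apply/imsetP; exists (x, next c x); rewrite // inE /= next_cycle.
Qed.

Lemma ucycle_del_notin r c s : ucycle r c -> s \notin cycle_edges c ->
  ucycle (del_edge r s) c.
Proof.
move=> /andP[cc uc] sc; rewrite /ucycle uc andbT.
apply: cycle_from_next => // x xc.
rewrite /del_edge (next_cycle cc xc) /=.
by apply: contraNneq sc => <-; apply/imsetP; exists x.
Qed.

(** Deleting an edge of one cycle that is not on the other, and then an edge of the other, keeps the
    graph connected, so at least [#|G| - 1] edges remain after losing two. *)
Lemma two_cycles_edge_set n1 n2 (C D : {set {set G}}) :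
  connected_graph G -> is_cycle n1 C -> is_cycle n2 D -> C != D ->
  #|G| < #|edge_set (@edge G)|.
Proof.
wlog: n1 n2 C D / ~~ (C \subset D) => [wl|].
  move=> cG cC cD CD; case: (boolP (C \subset D)) => [sCD|]; last first.
    by move=> h; exact: (wl n1 n2 C D).
  apply: (wl n2 n1 D C) => //; last by rewrite eq_sym.
  by apply: contra CD => sDC; rewrite finset.eqEsubset sCD.
move=> /subsetPn[s sC sD] [/card_gt0P[x _] cG] [c [<- c2 cc CE]] [b [<- b2 bc DE]] _.
rewrite {}CE {}DE in sC sD.
have eC := @edge_sym G.
have c1 := del_edge_connect eC cc c2 sC.
have bc1 := ucycle_del_notin bc sD.
case: b b2 bc bc1 sD => // y b b2 bc bc1 sD.
have tb : [set y; next (y :: b) y] \in cycle_edges (y :: b).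
  by apply/imsetP; exists y; rewrite ?mem_head.
set t := [set y; _] in tb.
have c3 := del_edge_connect (del_edge_sym s eC) bc1 b2 tb.
have h1 := @connected_edge_set _ x (fun v => c3 x v (c1 x v (cG x v))).
have h2 := edge_set_del (fintype.subsetP (cycle_edges_sub bc1) _ tb).
have h3 := edge_set_del (fintype.subsetP (cycle_edges_sub cc) _ sC).
lia.
Qed.

End Deletion.

(** * Covers given by permutations *)

Section PermCover.
Variables (G : sgraph) (k : nat) (g : G -> G -> {perm 'I_k}).

(** [enum_rank] orients every edge of [G], so that a single permutation [g u v], with [u] ranked
    below [v], defines its matching. *)
Definition perm_cover_edge : rel (G * 'I_k) := fun p q =>
  if p.1 == q.1 then p.2 != q.2 else
  edge p.1 q.1 && (if enum_rank p.1 < enum_rank q.1 then g p.1 q.1 p.2 == q.2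
                   else g q.1 p.1 q.2 == p.2).

Lemma perm_cover_sym : symmetric perm_cover_edge.
Proof.
move=> [u i] [v j]; rewrite /perm_cover_edge /= [v == u]eq_sym [j == i]eq_sym.
rewrite [edge v u]edge_sym; case: eqVneq => // uv; congr (_ && _).
have : enum_rank u != enum_rank v by rewrite (inj_eq enum_rank_inj).
by rewrite -val_eqE /=; case: ltngtP.
Qed.

Lemma perm_cover_irr : irreflexive perm_cover_edge.
Proof. by move=> [u i]; rewrite /perm_cover_edge /= !eqxx. Qed.

Definition perm_cover_graph : sgraph :=
  SGraph perm_cover_sym perm_cover_irr.

Definition perm_cover_list (u : G) : {set perm_cover_graph} :=
  [set p : G * 'I_k | p.1 == u].

Lemma perm_cover_listE u (p : perm_cover_graph) :
  (p \in perm_cover_list u) = (p.1 == u).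
Proof. by rewrite inE. Qed.

Lemma card_perm_cover_list (S : {set perm_cover_graph}) u :
  #|S :&: perm_cover_list u| = #|[set i | ((u, i) : perm_cover_graph) \in S]|.
Proof.
rewrite -(card_imset (mem [set i | _]) (f := fun i => ((u, i) : perm_cover_graph))).
  apply: eq_card => -[v i]; rewrite finset.in_setI perm_cover_listE /=.
  apply/andP/imsetP => [[vS /eqP <-]|[j + [-> ->]]].
    by exists i; rewrite // inE.
  by rewrite inE.
by move=> i j [].
Qed.

Lemma perm_cover_fold : is_fold_cover k perm_cover_list.
Proof.
split; last first.
  move=> u; rewrite -(finset.setTI (perm_cover_list u)) card_perm_cover_list.
  rewrite (_ : [set i | _] = [set: 'I_k]) ?cardsT ?card_ord //.
  by apply/setP=> i; rewrite !inE.
split.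
- split; last first.
    apply/setP=> p; rewrite inE; apply/bigcupP; exists p.1 => //.
    by rewrite perm_cover_listE.
  move=> u v uv; apply/pred0P => p /=; rewrite !perm_cover_listE.
  by apply/negP => /andP[/eqP pu /eqP pv]; rewrite -pu pv eqxx in uv.
- move=> u [v i] [w j]; rewrite !perm_cover_listE /= => /eqP -> /eqP ->.
  rewrite /edge /= /perm_cover_edge /= eqxx; apply: contra_neq => ->.
  by [].
- move=> u v uv /set0Pn[[[u' i] [v' j]]]; rewrite inE !perm_cover_listE /=.
  move=> /and3P[/eqP -> /eqP ->]; rewrite {1}/edge /= /perm_cover_edge /=.
  by rewrite (negbTE uv) => /andP[].
- move=> u v uv [[u1 i1] [v1 j1]] [[u2 i2] [v2 j2]].
  rewrite !inE /=.
  have nuv : u != v by apply: contraTneq uv => ->; rewrite edge_irr.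
  move=> /and3P[/eqP -> /eqP ->] + /and3P[/eqP -> /eqP ->].
  rewrite /edge /= /perm_cover_edge /= (negbTE nuv) uv /=.
  by case: ifP => _ /eqP <- /eqP <- [] [] => [->|/perm_inj ->|/perm_inj ->|->].
Qed.

Lemma perm_cover_coloring (R : realType) (eta : R) : DP_feasible R G k eta ->
  exists A : G -> {set 'I_k},
   (forall u v, edge u v -> enum_rank u < enum_rank v ->
      forall i, i \in A u -> g u v i \notin A v) /\
   (forall u, eta * k%:R <= #|A u|%:R)%R.
Proof.
move=> [_ /(_ _ _ perm_cover_fold)[S [qS cS]]].
exists (fun u => [set i | ((u, i) : perm_cover_graph) \in S]); split; last first.
  by move=> u; have := cS u; rewrite perm_cover_fold.2 card_perm_cover_list.
move=> u v uv ltuv i; rewrite !inE => iu; apply/negP => iv.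
have nuv : u != v by apply: contraTneq uv => ->; rewrite edge_irr.
have /setP/(_ ((u, i), (v, g u v i))) := qS _ _ nuv.
rewrite !inE /= iu iv !eqxx /= /edge /= /perm_cover_edge /=.
by rewrite (negbTE nuv) uv ltuv eqxx.
Qed.

End PermCover.

(** The image of [A] lies in the complement of [B], and equal sizes force equality. *)
Lemma perm_cover_half k (s : {perm 'I_k}) (A B : {set 'I_k}) :
  (forall i, i \in A -> s i \notin B) -> #|A| + #|B| <= k /\
  (#|A| + #|B| = k -> forall i, (i \in A) = (s i \notin B)).
Proof.
move=> AB; have sub : s @: A \subset ~: B.
  by apply/fintype.subsetP => _ /imsetP[i iA ->]; rewrite inE AB.
have cB := cardsC B; rewrite card_ord in cB.
have cA : #|s @: A| = #|A| by rewrite card_imset //; exact: perm_inj.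
have := subset_leq_card sub; rewrite cA => le; split; first by lia.
move=> E i; have /eqP : s @: A == ~: B by rewrite eqEcard sub cA; lia.
move=> /setP/(_ (s i)); rewrite (mem_imset _ _ (@perm_inj _ s)) => ->.
by rewrite inE.
Qed.

(** * Bounds on [theta_DP] from a single cycle *)

Section LowerBounds.
Variables (R : realType) (G : sgraph) (k : nat) (k0 : 0 < k).

(** Double counting of pairs of a cycle vertex and a label chosen there: every vertex has at least
    [eta * k] labels, every label at most [n.-1 / 2] vertices. *)
Lemma odd_cycle_feasible n (C : {set {set G}}) (eta : R) : odd n -> is_cycle n C ->
  DP_feasible R G k eta -> (eta * (2 * n)%:R <= n.-1%:R)%R.
Proof.
move=> on [c [sc n2 /andP[cc uc] _]] /(@perm_cover_coloring _ _ (fun _ _ => 1%g)).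
move=> [A [AD Ak]].
have cardc : #|mem c| = n by rewrite -sc; apply/card_uniqP.
have indep u i : u \in c -> i \in A u -> i \notin A (next c u).
  move=> uc' iu; have e := next_cycle cc uc'.
  case: (ltngtP (enum_rank u) (enum_rank (next c u))) => [lt|lt|/val_inj/enum_rank_inj E].
  - by have := AD _ _ e lt i iu; rewrite perm1.
  - apply/negP => iv; rewrite edge_sym in e.
    by have := AD _ _ e lt i iv; rewrite perm1 iu.
  - by rewrite -E edge_irr in e.
(* [I] and its shift along the cycle are disjoint, so [2 * #|I| <= n]; oddness of [n] saves one. *)
have half i : 2 * #|[set u in c | i \in A u]| <= n.-1.
  set I := [set u in c | _].
  have cI : #|next c @: I| = #|I|.
    by rewrite card_in_imset // => u v; rewrite !inE => _ _; apply: (can_inj (prev_next uc)).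
  have dI : [disjoint I & next c @: I].
    apply/pred0P => u /=; apply/negP => /andP[uI /imsetP[v + uv]].
    rewrite inE => /andP[vc iv]; have := indep v i vc iv.
    by move: uI; rewrite uv inE => /andP[_ ->].
  have : #|I :|: next c @: I| <= n.
    rewrite -cardc; apply/subset_leq_card/fintype.subsetP => u.
    rewrite inE => /orP[|/imsetP[v + ->]]; first by rewrite inE => /andP[].
    by rewrite inE => /andP[vc _]; rewrite mem_next.
  have := cardsUI I (next c @: I).
  rewrite (disjoint_setI0 dI) cards0 cI; lia.
have swap : \sum_(u in c) #|A u| = \sum_(i < k) #|[set u in c | i \in A u]|.
  under eq_bigr do rewrite -sum1_card.
  rewrite (exchange_big_dep predT) //=; apply: eq_bigr => i _.
  by rewrite -sum1_card; apply: eq_bigl => u; rewrite !inE.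
have up : 2 * (\sum_(u in c) #|A u|) <= k * n.-1.
  rewrite swap big_distrr /= -[X in X * _](card_ord k) -sum_nat_const.
  by apply: leq_sum => i _; exact: half.
have lo : (n%:R * (eta * k%:R) <= (\sum_(u in c) #|A u|)%:R)%R.
  rewrite natr_sum -cardc mulr_natl -sumr_const.
  by apply: ler_sum => u _; exact: Ak.
have kR : (0 < k%:R :> R)%R by rewrite ltr0n.
rewrite -(ler_pM2r kR) -natrM [n.-1 * k]mulnC.
apply: le_trans (_ : ((2 * \sum_(u in c) #|A u|)%:R <= _)%R); last by rewrite ler_nat.
rewrite !natrM; apply: le_trans (_ : (2 * (n%:R * (eta * k%:R)) <= _)%R).
  by rewrite [leRHS](_ : _ = eta * (2 * n%:R) * k%:R)%R //; ring.
by rewrite ler_pM2l.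
Qed.

(** The cyclic shift is transitive, so an invariant set is empty or everything. *)
Lemma ordS_invariant (B : {set 'I_k}) : (forall i, (ordS i \in B) = (i \in B)) ->
  2 * #|B| != k.
Proof.
case: k k0 B => // k' _ B Binv.
have cst i : (i \in B) = (ord0 \in B).
  case: i => n; elim: n => [|n IH] ltn.
    by congr (_ \in B); apply: val_inj.
  rewrite -(IH (ltnW ltn)) -(Binv (Ordinal (ltnW ltn))).
  by congr (_ \in B); apply: val_inj; rewrite /= modn_small.
case: (boolP (ord0 \in B)) => B0.
  rewrite (_ : B = [set: _]) ?cardsT ?card_ord; first by lia.
  by apply/setP => i; rewrite cst B0 inE.
rewrite (_ : B = finset.set0) ?cards0 //.
by apply/setP => i; rewrite cst (negbTE B0) inE.
Qed.

Lemma even_cycle_feasible n (C : {set {set G}}) (eta : R) : ~~ odd n ->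
  is_cycle n C -> DP_feasible R G k eta -> (eta < 2^-1)%R.
Proof.
move=> on [c [sc n2 cc _]] fe; rewrite ltNge; apply/negP => eta2.
have [s sE] : exists s, s \in cycle_edges c.
  case: c sc {cc} => [|x c] sc; first by rewrite -sc in n2.
  by exists [set x; next (x :: c) x]; apply/imsetP; exists x; rewrite ?mem_head.
have c2 : 2 < size c by rewrite sc.
have [x [y [t [sxy tn ct st _]]]] := cycle_edgesP cc c2 sE.
pose rho := perm (@ordS_inj k).
pose g u v := if [set u; v] == [set x; y] then rho else 1%g.
have [A [AD Ak]] := perm_cover_coloring g fe.
have {}Ak u : k <= 2 * #|A u|.
  rewrite -(ler_nat R) natrM -ler_pdivrMl //.
  by apply: le_trans (Ak u); apply: ler_wpM2r.
(* All sets have size at least [k / 2], so every edge is in the equality case of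
   [perm_cover_half]. *)
have compl u v : edge u v -> enum_rank u < enum_rank v ->
    (#|A u| + #|A v| = k /\ forall i, (i \in A u) = (g u v i \notin A v)).
  move=> e lt; have [le E] := perm_cover_half (AD u v e lt).
  have E' : #|A u| + #|A v| = k by move: (Ak u) (Ak v); lia.
  by split=> //; exact: E.
have rk (u v : G) : edge u v ->
    enum_rank u < enum_rank v \/ enum_rank v < enum_rank u.
  move=> e; case: (ltngtP (enum_rank u) (enum_rank v)) => [||/val_inj/enum_rank_inj E]; auto.
  by rewrite -E edge_irr in e.
have flip u v i : del_edge edge [set x; y] u v -> (i \in A v) = (i \notin A u).
  move=> /andP[e nuv]; case: (rk _ _ e) => lt.
    by have [_ /(_ i)] := compl _ _ e lt; rewrite /g (negbTE nuv) perm1 => ->; rewrite negbK.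
  rewrite edge_sym in e; rewrite finset.setUC in nuv.
  by have [_ /(_ i)] := compl _ _ e lt; rewrite /g (negbTE nuv) perm1.
have walk p w i : path (del_edge edge [set x; y]) w p ->
    (i \in A (last w p)) = (i \in A w) (+) odd (size p).
  elim: p w => [|z p IH] w /=; first by rewrite addbF.
  by move=> /andP[wz /IH ->]; rewrite (flip _ _ _ wz); case: (_ \in _); case: odd.
(* The path from [y] to [x] that avoids the shifted edge has odd length, so complementation along it
   makes [A x] and [A y] complementary; the shifted edge then forces shift-invariance. *)
have Axy i : (i \in A x) = (i \notin A y).
  have := walk _ _ i (ucycle_del tn ct); rewrite last_rcons size_rcons => ->.
  by move: on; rewrite -sc st /= negbK => ->; rewrite addbT.
have exy : edge x y by case/andP: ct => /andP[].
case: (rk _ _ exy) => lt.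
- have [cE gE] := compl _ _ exy lt.
  have inv i : (ordS i \in A y) = (i \in A y).
    by have := gE i; rewrite /g eqxx permE Axy => /negb_inj ->.
  by have := ordS_invariant inv; move: (Ak x) (Ak y); lia.
- have eyx : edge y x by rewrite edge_sym.
  have [cE gE] := compl _ _ eyx lt.
  have inv i : (ordS i \in A x) = (i \in A x).
    have := gE i; rewrite /g [[set y; x]]finset.setUC eqxx permE => gi.
    by rewrite [RHS]Axy gi negbK.
  by have := ordS_invariant inv; move: (Ak x) (Ak y); lia.
Qed.

End LowerBounds.

(** * Counting permutation covers *)

Section PermCount.
Variable T : finType.
Implicit Types (A B : {set T}) (s t : {perm T}).

(** By multiple transitivity of the symmetric group, some permutation carries an enumeration of [D]
    to its image under [f]. *)
Lemma perm_partial_ext (D : {set T}) (f : T -> T) : {in D &, injective f} ->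
  exists s, {in D, s =1 f}.
Proof.
move=> finj.
have t1 : size (enum D) == #|D| by rewrite -cardE.
have t2 : size (map f (enum D)) == #|D| by rewrite size_map.
have tr := ntransitive_weak (max_card D) (Sym_trans T).
have [||s _ sE] := atransP2 tr (x := Tuple t1) (y := Tuple t2).
- by rewrite inE /= enum_uniq; apply/fintype.subsetP => x _; rewrite inE.
- rewrite inE /= map_inj_in_uniq ?enum_uniq //.
    by apply/fintype.subsetP => x _; rewrite inE.
  by move=> x y; rewrite !mem_enum; exact: finj.
exists s => x xD; have /(congr1 (@tval _ _)) /= := sE.
by move=> /eq_in_map/(_ x); rewrite mem_enum => /(_ xD) /= ->.
Qed.

Lemma perm_imset_ex A B : #|A| = #|B| -> exists s, s @: A = B.
Proof.
move=> cAB; have [f fI fB] : exists2 f : T -> T, {in A &, injective f} & {in A, forall x, f x \in B}.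
  case: (set_0Vmem A) => [->|[a aA]].
    by exists id => x; rewrite inE.
  have [b bB] : exists b, b \in B by apply/card_gt0P; rewrite -cAB; apply/card_gt0P; exists a.
  have lt x : x \in A -> index x (enum A) < size (enum B).
    by move=> xA; rewrite -cardE -cAB cardE index_mem mem_enum.
  exists (fun x => nth b (enum B) (index x (enum A))) => [x y xA yA /eqP|x xA].
    by rewrite nth_uniq ?lt ?enum_uniq // => /eqP /index_inj ->; rewrite ?mem_enum.
  by have := mem_nth b (lt x xA); rewrite mem_enum.
have [s sE] := perm_partial_ext fI; exists s.
apply/eqP; rewrite eqEcard card_imset ?cAB ?leqnn ?andbT; last exact: perm_inj.
by apply/fintype.subsetP => _ /imsetP[x xA ->]; rewrite sE // fB.
Qed.

(** Right multiplication by a permutation taking [B] to [B'] injects one fibre into the other. *)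
Lemma card_perm_imset A B B' : #|B| = #|B'| ->
  #|[set s : {perm T} | s @: A == B]| = #|[set s : {perm T} | s @: A == B']|.
Proof.
suff le B1 B2 : #|B1| = #|B2| ->
    #|[set s : {perm T} | s @: A == B1]| <= #|[set s : {perm T} | s @: A == B2]|.
  by move=> E; apply/eqP; rewrite eqn_leq !le.
move=> /perm_imset_ex[t <-].
rewrite -(card_imset _ (@mulIg _ t)); apply/subset_leq_card/fintype.subsetP.
move=> _ /imsetP[s + ->]; rewrite !inE => /eqP <-; apply/eqP.
by rewrite -imset_comp; apply: eq_imset => x; rewrite /= permM.
Qed.

(** The image of [A] is uniformly distributed over the [a]-subsets, each being hit by [q]
    permutations, and ['C(#|T| - a, a)] of these subsets avoid [B]. *)
Lemma card_perm_disjoint A B a : #|A| = a -> #|B| = a ->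
  #|[set s : {perm T} | [disjoint s @: A & B]]| * 'C(#|T|, a)
    = (#|T|)`! * 'C(#|T| - a, a).
Proof.
move=> cA cB.
pose q := #|[set s : {perm T} | s @: A == A]|.
have count (P : pred {set T}) :
    #|[set s : {perm T} | P (s @: A)]| = #|[set B' | P B' & #|B'| == a]| * q.
  rewrite -sum_nat_const -sum1_card.
  rewrite (partition_big (fun s : {perm T} => s @: A) (mem [set B' | P B' & #|B'| == a])) /=.
    apply: eq_bigr => B'; rewrite inE => /andP[PB' /eqP cB'].
    rewrite sum1_card /q (@card_perm_imset A A B') ?cB' //.
    apply: eq_card => s; rewrite !inE; apply/andP/eqP => [[_ /eqP] //|sA].
    by rewrite inE sA PB' eqxx.
  move=> s; rewrite !inE => ->; rewrite card_imset ?cA ?eqxx //; exact: perm_inj.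
have all : (#|T|)`! = 'C(#|T|, a) * q.
  have := count xpredT; rewrite card_draws => <-.
  by rewrite -card_Sym; apply: eq_card => s; rewrite !inE.
rewrite (count (fun X => [disjoint X & B])) all mulnAC [RHS]mulnAC; congr (_ * _).
rewrite mulnC; congr (_ * _).
have -> : #|T| - a = #|~: B| by rewrite cardsCs finset.setCK cB.
rewrite -cards_draws; apply: eq_card => X; rewrite !inE.
by rewrite finset.disjoints_subset.
Qed.

End PermCount.

(** The union bound with denominators cleared: the [k!^m] choices of permutations are covered by the
    choices that each of the ['C(k, a) ^ #|G|] families colors. *)
Lemma perm_cover_count (G : sgraph) (k a : nat) :
  let m := #|[pred e : G * G | edge e.1 e.2 && (enum_rank e.1 < enum_rank e.2)]| in
  (forall g : G -> G -> {perm 'I_k}, exists A : G -> {set 'I_k},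
     (forall u v, edge u v -> enum_rank u < enum_rank v ->
        forall i, i \in A u -> g u v i \notin A v) /\
     (forall u, #|A u| = a)) ->
  'C(k, a) ^ m <= 'C(k, a) ^ #|G| * 'C(k - a, a) ^ m.
Proof.
move=> m hA.
pose O := [pred e : G * G | edge e.1 e.2 && (enum_rank e.1 < enum_rank e.2)].
(* One permutation per oriented edge, with the identity off [O] so that choices are counted once;
   [bad A] collects the choices that [A] does color. *)
pose F := pffun_on (1%g : {perm 'I_k}) O predT.
pose As := ffun_on (mem [set A : {set 'I_k} | #|A| == a]) : {pred {ffun G -> {set 'I_k}}}.
pose bad (A : {ffun G -> {set 'I_k}}) :=
  pfamily (1%g : {perm 'I_k}) O
    (fun e => mem [set s : {perm 'I_k} | [disjoint s @: A e.1 & A e.2]]).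
have cF : #|F| = k`! ^ m by rewrite card_pffun_on card_Sn.
have cAs : #|As| = 'C(k, a) ^ #|G| by rewrite card_ffun_on card_draws card_ord.
have cbad A : A \in As -> #|bad A| * 'C(k, a) ^ m = (k`! * 'C(k - a, a)) ^ m.
  move=> /ffun_onP cA; rewrite card_pfamily.
  have cA' u : #|A u| = a by have := cA u; rewrite !inE => /eqP.
  rewrite foldrE big_image /= -!prod_nat_const -big_split /=.
  apply: eq_bigr => e _; have := card_perm_disjoint (cA' e.1) (cA' e.2).
  by rewrite card_ord => <-.
have cover : #|F| <= \sum_(A in As) #|bad A|.
  rewrite -sum1_card; under [leqRHS]eq_bigr do rewrite -sum1_card.
  rewrite (exchange_big_dep predT) //= big_mkcond /=; apply: leq_sum => f _.
  case: ifP => // fF.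
  have [A [AD cA]] := hA (fun u v => f (u, v)).
  rewrite (bigD1 [ffun u => A u]) //=; apply/andP; split.
    by apply/ffun_onP => u; rewrite ffunE inE cA.
  apply/pfamilyP; split; first by case/pffun_onP: fF.
  move=> [u v] /andP[/= e lt]; rewrite inE !ffunE /=.
  apply/pred0P => j /=; apply/negP => /andP[/imsetP[i iu ->]].
  by apply/negP; exact: AD.
have fpos : 0 < k`! ^ m by rewrite expn_gt0 fact_gt0.
rewrite -(leq_pmul2l fpos) -{1}cF.
apply: leq_trans (leq_mul cover (leqnn _)) _.
rewrite big_distrl /= (eq_bigr _ cbad) sum_nat_const cAs expnMn.
by rewrite mulnCA.
Qed.

(** * Estimates for powers and binomial coefficients *)

Lemma bin_expn_bound (N a r : nat) : 'C(a + r, r) * N ^ a <= N.+1 ^ (a + r).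
Proof.
rewrite -addn1 expnDn.
have lt : r < (a + r).+1 by rewrite ltnS leq_addl.
by rewrite (bigD1 (Ordinal lt)) //= addnK exp1n muln1 leq_addr.
Qed.

(** After multiplication by [a!], the falling factorial dominates [2 ^ a * a!] factor by factor. *)
Lemma bin_half_bound (a r : nat) : 2 ^ a <= 'C(a + r + a, a).
Proof.
rewrite -(leq_pmul2r (fact_gt0 a)) bin_ffact.
elim: a => [|a IH] //.
have -> : a.+1 + r + a.+1 = (a + r + a).+2 by lia.
rewrite factS expnS ffactSS mulnACA; apply: leq_mul; first by lia.
apply: leq_trans IH _.
have mono n j : n ^_ j <= n.+1 ^_ j.
  by rewrite -!bin_ffact leq_mul2r leq_bin2l ?orbT.
exact: mono.
Qed.

(** [grow] is Bernoulli's inequality [(q / p)^t >= 1 + t / p] without denominators. *)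
Lemma ltn_expn_ex (c p q : nat) : 0 < p < q -> exists2 t, 0 < t & c * p ^ t < q ^ t.
Proof.
move=> /andP[p0 pq].
have grow t : p ^ t * (p + t) <= p * q ^ t.
  elim: t => [|t IH]; first by rewrite !expn0 addn0 mul1n muln1.
  rewrite !expnS; have pt : 0 < p ^ t by rewrite expn_gt0 p0.
  have h : q * (p ^ t * (p + t)) <= q * (p * q ^ t) by rewrite leq_mul2l IH orbT.
  have : p * p ^ t * (p + t.+1) <= q * (p ^ t * (p + t)).
    have -> : p * p ^ t * (p + t.+1) = p ^ t * (p * (p + t.+1)) by ring.
    have -> : q * (p ^ t * (p + t)) = p ^ t * (q * (p + t)) by ring.
    by rewrite leq_mul2l; apply/orP; right; nia.
  by move: h; lia.
exists (c * p).+1 => //; move: (grow (c * p).+1).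
set t := (c * p).+1; have pt : 0 < p ^ t by rewrite expn_gt0 p0.
move=> h; rewrite -(ltn_pmul2l p0); apply: leq_trans h.
have -> : p * (c * p ^ t) = p ^ t * (c * p) by ring.
by rewrite ltn_pmul2l // /t; lia.
Qed.

(** This is [(1 + 1/N)^m * (1 - m/N) <= 1] without denominators; truncated subtraction makes it
    trivial for [N <= m]. *)
Lemma expn_bernoulli (N m : nat) : N.+1 ^ m * (N - m) <= N ^ m.+1.
Proof.
elim: m => [|m IH]; first by rewrite expn0 subn0 mul1n.
case: (leqP N m) => Nm; first by rewrite (_ : N - m.+1 = 0) ?muln0 //; lia.
have h : N * (N.+1 ^ m * (N - m)) <= N * N ^ m.+1 by rewrite leq_mul2l IH orbT.
rewrite expnS [leqRHS]expnS; apply: leq_trans h.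
have -> : N.+1 * N.+1 ^ m * (N - m.+1) = N.+1 ^ m * (N.+1 * (N - m.+1)) by ring.
have -> : N * (N.+1 ^ m * (N - m)) = N.+1 ^ m * (N * (N - m)) by ring.
by rewrite leq_mul2l; apply/orP; right; nia.
Qed.

(* With [k = 2 a + r] and [N = 4 m], expanding [(N + 1)^(a + r)] gives
   ['C(a + r, r) <= (1 + 1/N)^a (N + 1)^r], whose [m]-th power is at most
   [(4/3)^a (N + 1)^(m r)], while ['C(2 a + r, a) >= 2 ^ a]. *)
Lemma bin_gap (m : nat) : 0 < m -> exists2 t, 0 < t & forall k a, 0 < a -> a <= k ->
  t * (k - 2 * a) <= a -> 'C(k - a, a) ^ m < 'C(k, a).
Proof.
move=> m0; have [N NE] : exists N, N = 4 * m by exists (4 * m).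
have N0 : 0 < N by lia.
(* The gap between 4/3 and 2, scaled by 3, has to absorb the factor [N.+1 ^ m]. *)
have [t t0 tP] := @ltn_expn_ex (N.+1 ^ m) 4 6 isT.
exists t => // k a a0 ak tr.
case: (ltnP (k - a) a) => [lt|le].
  by rewrite bin_small // exp0n // bin_gt0.
pose r := k - 2 * a.
have -> : k - a = a + r by rewrite /r; lia.
have {ak le}-> : k = a + r + a by rewrite /r; lia.
rewrite -/r in tr.
apply: leq_trans (bin_half_bound a r).
rewrite -[X in 'C(_, X)](addnK r) bin_sub ?leq_addl //.
have h1 : ('C(a + r, r) ^ m) * (N ^ a) ^ m <= (N.+1 ^ (a + r)) ^ m.
  by rewrite -expnMn leq_exp2r // bin_expn_bound.
have h2 : 3 * N.+1 ^ m <= 4 * N ^ m.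
  have := expn_bernoulli N m; rewrite expnS (_ : N - m = 3 * m); last by lia.
  move: (N.+1 ^ m) (N ^ m) => P Q; rewrite NE => h.
  by rewrite -(leq_pmul2l m0); lia.
(* At the power [t] the hypothesis [t * r <= a] bounds [(N.+1 ^ m) ^ (t * r)] by [(N.+1 ^ m) ^ a];
   the factor [3 ^ (a * t)] clears the denominators of 4/3. *)
have h3 : ('C(a + r, r) ^ m) ^ t * 3 ^ (a * t) < (2 ^ a) ^ t * 3 ^ (a * t).
  have Nt : 0 < N ^ (m * a * t) by rewrite expn_gt0 N0.
  rewrite -(ltn_pmul2r Nt).
  have -> : ('C(a + r, r) ^ m) ^ t * 3 ^ (a * t) * N ^ (m * a * t)
          = ('C(a + r, r) ^ m * (N ^ a) ^ m) ^ t * 3 ^ (a * t).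
    have -> : N ^ (m * a * t) = ((N ^ a) ^ m) ^ t by rewrite -!expnM; congr (_ ^ _); ring.
    by rewrite mulnAC -expnMn.
  apply: (@leq_ltn_trans (((N.+1 ^ (a + r)) ^ m) ^ t * 3 ^ (a * t))).
    by rewrite leq_mul2r leq_exp2r // h1 orbT.
  have -> : ((N.+1 ^ (a + r)) ^ m) ^ t * 3 ^ (a * t)
      = (N.+1 ^ m) ^ (t * r) * (3 * N.+1 ^ m) ^ (a * t).
    rewrite expnMn -!expnM [RHS]mulnCA -[in RHS]expnD [RHS]mulnC.
    congr (_ ^ _ * _); ring.
  apply: (@leq_ltn_trans ((N.+1 ^ m) ^ a * (4 * N ^ m) ^ (a * t))).
    by apply: leq_mul; [rewrite leq_pexp2l // expn_gt0|rewrite leq_exp2r // muln_gt0 a0].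
  have -> : (2 ^ a) ^ t * 3 ^ (a * t) * N ^ (m * a * t)
      = (6 ^ t) ^ a * (N ^ m) ^ (a * t).
    by rewrite (_ : 6 = 2 * 3) // !expnMn -!expnM [t * a]mulnC mulnA.
  have -> : (N.+1 ^ m) ^ a * (4 * N ^ m) ^ (a * t)
      = (N.+1 ^ m * 4 ^ t) ^ a * (N ^ m) ^ (a * t).
    by rewrite !expnMn -!expnM [t * a]mulnC mulnA.
  by rewrite ltn_pmul2r ?expn_gt0 ?N0 // ltn_exp2r.
by move: h3; rewrite ltn_pmul2r ?expn_gt0 // ltn_exp2r.
Qed.

(** * Coloring unicyclic graphs *)

(** The set grows along orbits of [s]: adding the one image that leaves it repairs the old defect,
    and only the new element can leave. *)
Lemma perm_near_invariant_set (T : finType) (s : {perm T}) (a : nat) : a <= #|T| ->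
  exists A : {set T}, #|A| = a /\ #|[set i in A | s i \notin A]| <= 1.
Proof.
elim: a => [|a IH] ale.
  exists finset.set0; rewrite cards0; split=> //.
  by rewrite (_ : [set i in _ | _] = finset.set0) ?cards0 //; apply/setP => i; rewrite !inE.
have [A [cA bA]] := IH (ltnW ale).
have [z zA zbad] : exists2 z, z \notin A & forall i, i \in A -> s i \notin A -> s i = z.
  case: (set_0Vmem [set i in A | s i \notin A]) => [b0|[i0 i0b]].
    have /card_gt0P[z] : 0 < #|~: A| by have := cardsC A; lia.
    rewrite inE => zA; exists z => // i iA si.
    by have /setP/(_ i) := b0; rewrite !inE iA si.
  move: (i0b); rewrite inE => /andP[_ si0]; exists (s i0) => // i iA si.
  have/eqP/setP/(_ i) : [set i0] == [set i in A | s i \notin A].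
    by rewrite eqEcard finset.sub1set i0b cards1.
  by rewrite [RHS]inE iA si inE => /eqP ->.
exists (z |: A); rewrite cardsU1 zA cA; split=> //.
rewrite -(cards1 z); apply/subset_leq_card/fintype.subsetP => i.
rewrite !inE negb_or => /andP[/predU1P[-> _|iA /andP[siz siA]]]; first exact: eqxx.
by case/eqP: siz; exact: zbad.
Qed.

Section Coloring.
Variables (G H : sgraph) (L : G -> {set H}) (k : nat).

Lemma fold_cover_labels : is_fold_cover k L ->
  exists h : G -> 'I_k -> H,
    (forall u, injective (h u)) /\ (forall u i, h u i \in L u).
Proof.
move=> [_ cL]; exists (fun u i => enum_val (cast_ord (esym (cL u)) i)); split.
- by move=> u i j /enum_val_inj/cast_ord_inj.
- by move=> u i; exact: enum_valP.
Qed.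

(** On labels a matching is a partial injection, which extends to a permutation. *)
Lemma cover_matching_perm (h : G -> 'I_k -> H) u v : is_cover L ->
  (forall u, injective (h u)) -> (forall u i, h u i \in L u) -> u != v ->
  exists s : {perm 'I_k}, forall i j, edge (h u i) (h v j) -> s i = j.
Proof.
move=> [_ _ cE cM] hI hL uv.
have match_eq i j i' j' : edge (h u i) (h v j) -> edge (h u i') (h v j') ->
    i = i' \/ j = j' -> (i, j) = (i', j').
  move=> e e' ii; have emem w w' : edge (h u w) (h v w') ->
      (h u w, h v w') \in edges_between (L u) (L v) by rewrite inE /= !hL.
  have euv : edge u v by apply: cE => //; apply/set0Pn; exists (h u i, h v j); exact: emem.
  have : (h u i, h v j) = (h u i', h v j').
    by apply: (cM _ _ euv) (emem _ _ e) (emem _ _ e') _; case: ii => ->; [left|right].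
  by case=> /hI -> /hI ->.
(* The default [i] is harmless, as [f] is only used on matched labels. *)
pose f i := odflt i [pick j | edge (h u i) (h v j)].
have fP i j : edge (h u i) (h v j) -> f i = j.
  rewrite /f; case: pickP => [j' /= e' e|/(_ j) /= -> //].
  by have [] := match_eq _ _ _ _ e' e (or_introl erefl).
have [|s sE] := @perm_partial_ext _ [set i | [exists j, edge (h u i) (h v j)]] f.
  move=> i i'; rewrite !inE => /existsP[j e] /existsP[j' e'].
  rewrite (fP _ _ e) (fP _ _ e') => jj.
  by have [] := match_eq _ _ _ _ e e' (or_intror jj).
exists s => i j e; rewrite sE; first exact: fP.
by rewrite inE; apply/existsP; exists j.
Qed.

(* Relabelling the lists along the tree makes every matching on a tree edge a
   restriction of the identity; the only other edge then carries a partial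
   permutation [sigma], and [A] on even levels, its complement on odd levels is
   a colouring once the at most one element leaving [A] under [sigma] is
   removed from the list of the root. *)
Lemma tree_plus_edge_coloring (a : nat) (x y : G) (d : G -> nat) (p : G -> G) :
  k = 2 * a -> d x = 0 -> (forall v, v != x -> d v = (d (p v)).+1) ->
  (forall u v : G, edge u v -> [\/ v != x /\ u = p v, u != x /\ v = p u |
     odd (d y) /\ [set u; v] = [set x; y]]) ->
  is_fold_cover k L ->
  exists S, quasi_independent L S /\ forall u, a <= #|S :&: L u|.+1.
Proof.
move=> kE dx dp eP cL; have [cov cK] := cL.
have [h [hI hL]] := fold_cover_labels cL.
have pv v : v != x -> p v != v.
  by move=> /dp dv; apply: contra_eq_neq dv => ->; lia.
have /choice[s sP] v : exists s : {perm 'I_k}, v != x ->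
    forall i j, edge (h (p v) i) (h v j) -> s i = j.
  case: (eqVneq v x) => [_|vx]; first by exists 1%g.
  by have [s sP] := cover_matching_perm cov hI hL (pv v vx); exists s.
(* The product of the tree permutations from the root down to [v], with the depth as fuel; [g] is
   the relabelling it induces. *)
pose F := fix F n v : {perm 'I_k} := if n is n'.+1 then (F n' (p v) * s v)%g else 1%g.
pose g v i := h v (F (d v) v i).
have gI v : injective (g v) by move=> i j /hI /perm_inj.
have gL v i : g v i \in L v by exact: hL.
have gT v i j : v != x -> edge (g (p v) i) (g v j) -> i = j.
  move=> vx; rewrite /g => /(sP v vx); rewrite (dp v vx) /= permM.
  by move=> /perm_inj /perm_inj.
have [sigma sigmaP] : exists sigma : {perm 'I_k}, x != y ->
    forall i j, edge (g x i) (g y j) -> sigma i = j.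
  case: (eqVneq x y) => [_|xy]; first by exists 1%g.
  by have [t tP] := cover_matching_perm cov gI gL xy; exists t.
have [|A [cA bA]] := perm_near_invariant_set sigma (a := a).
  by rewrite card_ord kE; lia.
pose B v := if odd (d v) then ~: A else
  if v == x then A :\: [set i in A | sigma i \notin A] else A.
pose S := \bigcup_v (g v @: B v).
have [[Ldisj _] _ Ledge _] := cov.
have SL u : S :&: L u = g u @: B u.
  apply/setP => q; rewrite inE; apply/andP/idP => [[/bigcupP[v _ /imsetP[i iB qE]] qL]|].
    case: (eqVneq v u) => [<-|vu]; first by apply/imsetP; exists i.
    have /pred0P/(_ q) := Ldisj _ _ vu; rewrite /= qL andbT qE.
    by rewrite gL.
  move=> qB; split; first by apply/bigcupP; exists u.
  by case/imsetP: qB => i _ ->.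
exists S; split; last first.
  move=> u; rewrite SL card_imset //; rewrite /B.
  have := etrans (cardsC A) (etrans (card_ord k) kE); rewrite cA => cAC.
  case: ifP => _; first by lia.
  case: ifP => _; last by lia.
  rewrite cardsD cA (finset.setIidPr _); first by lia.
  by apply/fintype.subsetP => i; rewrite inE => /andP[].
have BA v i : i \in B v -> (i \in A) = ~~ odd (d v).
  rewrite /B; case: ifP => _; first by rewrite inE => /negbTE.
  by case: ifP => _ //; rewrite inE => /andP[].
move=> u v uv; apply/setP => -[q q']; rewrite !inE /=; apply/negP.
rewrite -!finset.in_setI !SL.
move=> /and3P[/imsetP[i iB ->] /imsetP[j jB ->] e].
have euv : edge u v.
  apply: Ledge => //; apply/set0Pn; exists (g u i, g v j).
  by rewrite inE /= !gL.
(* A label kept at the root has its [sigma]-image in [A], whereas the odd level of [y] uses the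
   complement of [A]. *)
have xyP i' j' : odd (d y) -> i' \in B x -> j' \in B y -> ~ edge (g x i') (g y j').
  move=> oy iB' jB' e'.
  have xy : x != y by apply: contraTneq oy => <-; rewrite dx.
  have := sigmaP xy _ _ e'; move: iB'; rewrite {1}/B dx /= eqxx !inE.
  move=> /andP[+ iA] sE; rewrite iA /= sE negbK.
  by rewrite (BA _ _ jB') oy.
case: (eP u v euv) => [[vx uE]|[ux vE]|[oy /set2_eq E]].
- rewrite uE in iB e; have ij := gT _ _ _ vx e.
  have := BA _ _ jB; rewrite -ij (BA _ _ iB) (dp v vx) /=.
  by case: odd.
- rewrite vE edge_sym in e; rewrite vE in jB; have ij := gT _ _ _ ux e.
  have := BA _ _ iB; rewrite -ij (BA _ _ jB) (dp u ux) /=.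
  by case: odd.
- case: E => -[uE vE]; subst u v; first exact: xyP e.
  by rewrite edge_sym in e; exact: xyP e.
Qed.

End Coloring.

(** * The fractional DP-chromatic number *)

(** If there is a cycle, an edge [xy] of it is removed and [x] becomes the root; a cycle in the rest
    would be a second even cycle. *)
Lemma unicyclic_spanning_tree (G : sgraph) : connected_graph G ->
  no_odd_cycle G -> at_most_one_even_cycle G ->
  exists (x y : G) (d : G -> nat) (p : G -> G),
    [/\ d x = 0, forall v, v != x -> d v = (d (p v)).+1 &
     forall u v : G, edge u v -> [\/ v != x /\ u = p v, u != x /\ v = p u |
     odd (d y) /\ [set u; v] = [set x; y]]].
Proof.
move=> [/card_gt0P[x0 _] cG] noodd onev.
have eC := @edge_sym G; have eI := @edge_irr G.
have even (c : seq G) : 2 < size c -> ucycle edge c ->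
    ~~ odd (size c) /\ even_cycle (cycle_edges c).
  move=> c2 cc; have cyc : is_cycle (size c) (cycle_edges c) by exists c.
  have on : ~~ odd (size c) by apply/negP => oc; have [] := noodd (cycle_edges c); exists (size c).
  by split=> //; exists (size c).
have [[c c2 cc]|acyc] := pselect (exists2 c : seq G, 2 < size c & ucycle edge c); last first.
  have [d [p st]] := bfs_tree (cG x0).
  (* In a tree the root also serves as [y]: its level 0 is even, and the third case never arises. *)
  have [d0 dp] := st; exists x0, x0, d, p; split=> // [v /dp[]|u v uv] //.
  have [||] := spans_tree_edges eC eI st _ uv; [|by constructor 1|by constructor 2].
  by move=> c c2 cc; apply: acyc; exists c.
have [s sE] : exists s, s \in cycle_edges c.
  case: c c2 {cc} => [|x c] // _.
  by exists [set x; next (x :: c) x]; apply/imsetP; exists x; rewrite ?mem_head.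
have [x [y [t [sxy tn ct st _]]]] := cycle_edgesP cc c2 sE; subst s.
set r := del_edge edge [set x; y].
have rC : symmetric r by exact: del_edge_sym.
have rI : irreflexive r by move=> u; rewrite /r /del_edge eI.
have rsub : subrel r edge by move=> u v /andP[].
have cr v : connect r x v by apply: (del_edge_connect eC cc).
have [d [p tr]] := bfs_tree cr.
have racyc b : 2 < size b -> ~ ucycle r b.
  move=> b2 rb; have bb : ucycle edge b.
    by case/andP: rb => rb ub; rewrite /ucycle (sub_cycle rsub rb).
  have CB := onev _ _ (even c c2 cc).2 (even b b2 bb).2.
  have /imsetP[[u v]] : [set x; y] \in edge_set r.
    by apply: (fintype.subsetP (cycle_edges_sub rb)); rewrite -CB.
  by rewrite inE => /andP[_ /= ne] E; rewrite E eqxx in ne.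
have redge := spans_tree_edges rC rI tr racyc.
have [d0 dp] := tr.
exists x, y, d, p; split=> // [v /dp[]|u v uv] //.
  case: (eqVneq [set u; v] [set x; y]) => [E|ne]; last first.
    have [||] := redge u v; [by rewrite /r /del_edge uv|by constructor 1|by constructor 2].
  constructor 3; split=> //.
  (* Tree edges change the level by one, and the remaining path from [y] to [x] has odd length, so
     [y] has odd level. *)
  have walk w q : path r w q -> odd (d (last w q)) = odd (d w) (+) odd (size q).
    elim: q w => [|z q IH] w /=; first by rewrite addbF.
    move=> /andP[wz /IH ->].
    have : odd (d z) = ~~ odd (d w).
      have [[zx ->]|[wx ->]] := redge _ _ wz; first by rewrite (dp z zx).2.
      by rewrite (dp w wx).2 /= negbK.
    by move=> ->; case: (odd (d w)); case: (odd (size q)).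
  have := walk _ _ (ucycle_del tn ct); rewrite last_rcons size_rcons d0 /=.
  have := (even c c2 cc).1; rewrite st /= negbK => ->.
  by case: odd.
Qed.

Section InverseTheta.
Variables (R : realType) (G : sgraph) (k : nat).
Local Open Scope ring_scope.

Lemma theta_DP_ge0 : 0 <= theta_DP R G k.
Proof. by have [_] := theta_DP_max R G k; apply; exact: DP_feasible0. Qed.

Lemma inv_theta_DP_le (c : R) : 0 < c -> DP_feasible R G k c ->
  (inv_theta_DP R G k <= (c^-1)%:E)%E.
Proof.
move=> c0 /(theta_DP_max R G k).2 ct; have t0 := lt_le_trans c0 ct.
by rewrite /inv_theta_DP inver gt_eqF // lee_fin lef_pV2.
Qed.

Lemma inv_theta_DP_ge (c : R) : 0 < c -> theta_DP R G k <= c ->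
  ((c^-1)%:E <= inv_theta_DP R G k)%E.
Proof.
move=> c0 tc; rewrite /inv_theta_DP inver.
case: eqP => [_|/eqP t0]; first exact: leey.
have tp : 0 < theta_DP R G k by rewrite lt_neqAle eq_sym t0 theta_DP_ge0.
by rewrite lee_fin lef_pV2.
Qed.

Lemma inv_theta_DP_gt (c : R) : 0 < c -> theta_DP R G k < c ->
  ((c^-1)%:E < inv_theta_DP R G k)%E.
Proof.
move=> c0 tc; rewrite /inv_theta_DP inver.
case: eqP => [_|/eqP t0]; first exact: ltey.
have tp : 0 < theta_DP R G k by rewrite lt_neqAle eq_sym t0 theta_DP_ge0.
by rewrite lte_fin ltf_pV2.
Qed.

End InverseTheta.

(** A bound uniform in [k] is what keeps the infimum itself above 2. *)
Lemma chi_DP_frac_gt2 (R : realType) (G : sgraph) (c : R) : (0 < c < 2^-1)%R ->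
  (forall k, 0 < k -> (theta_DP R G k <= c)%R) -> (2%:E < chi_DP_frac R G)%E.
Proof.
move=> /andP[c0 c2] tc; apply: (@lt_le_trans _ _ ((c^-1)%:E)).
  by rewrite lte_fin -[X in (X < _)%R]invrK ltf_pV2 // posrE invr_gt0.
apply: le_ereal_inf_tmp => _ [k k0 <-].
by apply: inv_theta_DP_ge => //; exact: tc.
Qed.

Lemma unicyclic_chi_DP_frac_le2 (R : realType) (G : sgraph) : connected_graph G ->
  no_odd_cycle G -> at_most_one_even_cycle G -> (chi_DP_frac R G <= 2%:E)%E.
Proof.
move=> cG noodd onev.
have [x [y [d [p [dx dp eP]]]]] := unicyclic_spanning_tree cG noodd onev.
(* This is [(a - 1) / 2a] with [a = b + 2], which keeps it positive; its inverse is
   [2 + 2 / (b + 1)]. *)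
have feas b : DP_feasible R G (2 * b.+2) (b.+1%:R / (2 * b.+2)%:R)%R.
  have pos : (0 < (2 * b.+2)%:R :> R)%R by rewrite ltr0n.
  split.
    by rewrite divr_ge0 ?ler0n //= ler_pdivrMr // mul1r ler_nat; lia.
  move=> H L cL; have [S [qS cS]] := tree_plus_edge_coloring erefl dx dp eP cL.
  exists S; split=> // u; rewrite cL.2 divfK ?gt_eqF // ler_nat.
  exact: cS.
apply/lee_addgt0Pr => e e0.
have [b be] : exists b : nat, (2 / b.+1%:R <= e)%R.
  exists (Num.bound (2 / e)%R); rewrite ler_pdivrMr ?ltr0n // -ler_pdivrMl //.
  rewrite mulrC (le_trans (ltW (archi_boundP _))) ?divr_ge0 ?(ltW e0) //.
  by rewrite ler_nat.
apply: ge_ereal_inf; exists (inv_theta_DP R G (2 * b.+2)); first by exists (2 * b.+2).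
apply: le_trans (inv_theta_DP_le _ (feas b)) _; first by rewrite divr_gt0 ?ltr0n.
rewrite -EFinD lee_fin invf_div; apply: le_trans (_ : (2 + 2 / b.+1%:R <= _)%R).
  have b0 : (b.+1%:R != 0 :> R)%R by rewrite pnatr_eq0.
  rewrite ler_pdivrMr ?ltr0n // mulrDl divfK // -natrM -natrD ler_nat; lia.
by rewrite lerD2l.
Qed.

Lemma odd_cycle_chi_DP_frac (R : realType) (G : sgraph) (C : {set {set G}}) :
  odd_cycle C -> (2%:E < chi_DP_frac R G)%E.
Proof.
move=> [n on cC]; have n2 : 2 < n by case: cC => c [].
apply: (@chi_DP_frac_gt2 _ _ (n.-1%:R / (2 * n)%:R)%R).
  have n0 : (0 < (2 * n)%:R :> R)%R by rewrite ltr0n; lia.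
  rewrite divr_gt0 //=; last by rewrite ltr0n; lia.
  rewrite ltr_pdivrMr // natrM mulKf ?pnatr_eq0 // ltr_nat; lia.
move=> k k0; rewrite ler_pdivlMr; last by rewrite ltr0n; lia.
exact: odd_cycle_feasible on cC (theta_DP_max R G k).1.
Qed.

Lemma two_even_cycles_chi_DP_frac (R : realType) (G : sgraph) (C D : {set {set G}}) :
  connected_graph G -> even_cycle C -> even_cycle D -> C != D ->
  (2%:E < chi_DP_frac R G)%E.
Proof.
move=> cG [n1 _ cC] [n2 _ cD] CD.
have := two_cycles_edge_set cG cC cD CD.
pose O := [pred e : G * G | edge e.1 e.2 && (enum_rank e.1 < enum_rank e.2)].
have : #|edge_set (@edge G)| <= #|O|.
  apply: leq_trans (leq_imset_card (fun e : G * G => [set e.1; e.2]) O).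
  apply/subset_leq_card/fintype.subsetP => _ /imsetP[[u v] + ->].
  rewrite inE /= => e; apply/imsetP.
  case: (ltngtP (enum_rank u) (enum_rank v)) => [lt|lt|/val_inj/enum_rank_inj E].
  - by exists (u, v); rewrite ?inE /= ?e.
  - by exists (v, u); rewrite ?inE /= 1?edge_sym ?e // finset.setUC.
  - by rewrite E edge_irr in e.
move=> leEO ltGE; have ltGO := leq_trans ltGE leEO.
have [|t t0 tP] := @bin_gap #|O|; first by lia.
(* The threshold [t / q] lies below 1/2, and [t * k < q * a] gives [t * (k - 2 * a) <= a], as
   [bin_gap] requires. *)
pose q := (2 * t).+1.
have q0 : (0 < q%:R :> R)%R by rewrite ltr0n.
apply: (@chi_DP_frac_gt2 _ _ (t%:R / q%:R)%R).
  rewrite divr_gt0 ?ltr0n //= ltr_pdivrMr // ltr_pdivlMl // -natrM ltr_nat.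
  by rewrite /q.
move=> k k0; rewrite leNgt; apply/negP => tq.
have feas := (theta_DP_max R G k).1.
set eta := theta_DP R G k in tq feas.
pose a := ((t * k) %/ q).+1.
have aP j : (eta * k%:R <= j%:R)%R -> a <= j.
  move=> ej; rewrite /a ltn_divLR // -(ltr_nat R) !natrM.
  apply: lt_le_trans (_ : (eta * k%:R * q%:R <= _)%R).
    rewrite mulrAC ltr_pM2r ?ltr0n // -ltr_pdivrMr //.
  by rewrite ler_pM2r.
have col (g : G -> G -> {perm 'I_k}) : exists A : G -> {set 'I_k},
     (forall u v, edge u v -> enum_rank u < enum_rank v ->
        forall i, i \in A u -> g u v i \notin A v) /\
     (forall u, #|A u| = a).
  have [A [AD Ak]] := perm_cover_coloring g feas.
  (* The counting needs sets of size exactly [a]; shrinking them keeps the coloring valid. *)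
  have /choice[A' A'P] u : exists X : {set 'I_k}, X \subset A u /\ #|X| = a.
    have : a <= #|A u| by exact: aP.
    rewrite -bin_gt0 -cards_draws => /card_gt0P[X]; rewrite inE => /andP[XA /eqP cX].
    by exists X.
  exists A'; split=> [u v e lt i iu|u]; last exact: (A'P u).2.
  apply/negP => iv; have := AD u v e lt i (fintype.subsetP (A'P u).1 _ iu).
  by rewrite (fintype.subsetP (A'P v).1 _ iv).
have ak : a <= k.
  have [A [_ Aa]] := col (fun _ _ => 1%g).
  case: cG => /card_gt0P[x _] _; rewrite -(Aa x) -[leqRHS](card_ord k).
  exact: max_card.
have := perm_cover_count col; rewrite -/O.
have gap : 'C(k - a, a) ^ #|O| < 'C(k, a).
  apply: tP => //; have := ltn_ceil (t * k) (isT : 0 < q).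
  rewrite -/a /q mulnC; lia.
have Cpos : 0 < 'C(k, a) by rewrite bin_gt0.
(* Cancelling ['C(k, a) ^ #|G|] leaves a positive power of ['C(k, a)], since there are more edges
   than vertices; this contradicts [gap]. *)
rewrite -(subnKC (ltnW ltGO)) {1}expnD leq_pmul2l ?expn_gt0 ?Cpos //.
rewrite subnKC ?(ltnW ltGO) // leqNgt => /negP; apply.
apply: leq_trans gap _.
by rewrite -{1}(expn1 'C(k, a)) leq_pexp2l // subn_gt0.
Qed.

Theorem theorem1p5 (R : realType) (G : sgraph) (hG : connected_graph G) :
  ((chi_DP_frac R G <= 2%:E)%E <->
     no_odd_cycle G /\ at_most_one_even_cycle G) /\
  (no_odd_cycle G -> exactly_one_even_cycle G ->
     chi_DP_frac R G = 2%:E /\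
     forall k : nat, (0 < k)%N -> (2%:E < inv_theta_DP R G k)%E).
Proof.
split.
  split=> [le2|[]]; last exact: unicyclic_chi_DP_frac_le2.
  split=> [C oC|C D eC eD].
    by have := odd_cycle_chi_DP_frac R oC; rewrite ltNge le2.
  apply/eqP/negPn/negP => CD.
  by have := two_even_cycles_chi_DP_frac R hG eC eD CD; rewrite ltNge le2.
move=> noodd [C [[n en cC] uniC]].
(* [theta_DP] is a maximum, hence itself feasible, so the strict bound for the even cycle applies to
   it. *)
have gt2 k : 0 < k -> (2%:E < inv_theta_DP R G k)%E.
  move=> k0; rewrite -[X in X%:E]invrK; apply: inv_theta_DP_gt => //.
  by apply: (even_cycle_feasible k0 en cC); exact: (theta_DP_max R G k).1.
split=> //; apply/eqP; rewrite eq_le; apply/andP; split.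
  apply: unicyclic_chi_DP_frac_le2 => // D E eD eE.
  by rewrite -(uniC _ eD) -(uniC _ eE).
by apply: le_ereal_inf_tmp => _ [k k0 <-]; exact: ltW (gt2 k k0).
Qed.
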